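(* Let $\mathbf{F}_2$ be the group freely generated by $a,b$, and for $N\in\mathbb{N}$ let $B_N\subseteq\mathbf{F}_2$ be the set of reduced words of length at most $N$ in the alphabet $\{a,a^{-1},b,b^{-1}\}$. For any measure preserving system $(X,\mathcal{B},\mu,(T_{(g,h)})_{(g,h)\in \mathbf{F}_2\times\mathbf{F}_2})$ and any $Y\in\mathcal{B}$, there is $C\subseteq\mathbf{F}_2$ such that $$\overline{d}_{(B_N)_{N\in\mathbb{N}}}(C)=\limsup_{N\to\infty}\frac{|C\cap B_N|}{|B_N|}\geq\mu(Y)^2$$ and $$C\times C\subseteq\{(g,h)\in\mathbf{F}_2\times\mathbf{F}_2:\mu(Y\cap T_{(g,h)}Y)>0\}.$$
   Context: For a group $K$, a measure preserving system $(X,\mathcal{B},\mu,(T_k)_{k\in K})$ consists of a probability space $(X,\mathcal{B},\mu)$ and a left action $(T_k)_{k\in K}$ of $K$ on $X$ by measure-preserving maps, so that $T_{kl}=T_k\circ T_l$. *)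

(* Defs.v *)
From HB Require Import structures.
From mathcomp Require Import all_boot all_order all_algebra.
From mathcomp Require Import finmap.
From mathcomp Require Import all_classical all_reals all_analysis.

Set Implicit Arguments.
Unset Strict Implicit.
Unset Printing Implicit Defensive.

(* (false, true), (false, false), (true, true), (true, false) stand for
   a, a^-1, b, b^-1 respectively. *)
Notation letter := (bool * bool)%type.

Definition invl (l : letter) : letter := (l.1, ~~ l.2).

Definition reduced (w : seq letter) : bool :=
  sorted (fun l m => m != invl l) w.

Record F2 := ReducedWord { word : seq letter; word_reduced : reduced word }.

HB.instance Definition _ := [isSub for word].
HB.instance Definition _ := [Countable of F2 by <:].

(* Reduced form of l :: w, for w reduced. *)
Definition consl (l : letter) (w : seq letter) : seq letter :=
  if w is m :: w' then if m == invl l then w' else l :: w else [:: l].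

(* Reduced form of u ++ v, for v reduced. *)
Definition mulw (u v : seq letter) : seq letter := foldr consl v u.

Definition invw (w : seq letter) : seq letter := rev (map invl w).

Section FreeGroup.

Lemma invlK : involutive invl.
Proof. by case=> a b; rewrite /invl /= negbK. Qed.

Lemma reduced_behead l w : reduced (l :: w) -> reduced w.
Proof. exact: path_sorted. Qed.

Lemma consl_reduced l w : reduced w -> reduced (consl l w).
Proof.
case: w => [//|m w] rw /=; case: ifPn => [_|ne]; first exact: reduced_behead rw.
by rewrite /reduced /= ne.
Qed.

Lemma mulw_reduced u v : reduced v -> reduced (mulw u v).
Proof. by move=> rv; elim: u => [//|l u IH]; exact: consl_reduced. Qed.

Lemma consl_id l w : reduced (l :: w) -> consl l w = l :: w.
Proof. by case: w => [//|m w] /= /andP[/negPf ->]. Qed.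

Lemma conslK l w : reduced w -> consl l (consl (invl l) w) = w.
Proof.
case: w => [|m w] rw /=; first by rewrite eqxx.
rewrite invlK; case: (m =P l) => [<-|_]; last by rewrite /= eqxx.
exact: consl_id.
Qed.

Lemma conslVK l w : reduced w -> consl (invl l) (consl l w) = w.
Proof. by move=> rw; rewrite -{2}[l]invlK conslK. Qed.

Lemma mulw_consl l u v : reduced v -> mulw (consl l u) v = consl l (mulw u v).
Proof.
move=> rv; case: u => [//|m u] /=; case: (m =P invl l) => [->|//].
by rewrite conslK // mulw_reduced.
Qed.

Lemma mulwA u v w : reduced w -> mulw u (mulw v w) = mulw (mulw u v) w.
Proof. by move=> rw; elim: u => [//|l u IH] /=; rewrite mulw_consl // -IH. Qed.

Lemma mulw0 u : reduced u -> mulw u [::] = u.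
Proof.
elim: u => [//|l u IH] ru; rewrite /= IH; first exact: consl_id.
exact: reduced_behead ru.
Qed.

Lemma invw_reduced w : reduced w -> reduced (invw w).
Proof.
rewrite /reduced /invw rev_sorted sorted_map; apply: sub_sorted => l m.
by apply: contra => /= /eqP ->; rewrite invlK.
Qed.

Lemma invwK : involutive invw.
Proof. by move=> w; rewrite /invw map_rev revK mapK //; exact: invlK. Qed.

Lemma mulVw w : mulw (invw w) w = [::].
Proof.
have H u v : reduced v -> mulw (invw u) (mulw u v) = v.
  elim: u v => [//|l u IH] v rv.
  rewrite /invw /= rev_cons -cats1 /mulw foldr_cat /=.
  by rewrite conslVK ?mulw_reduced //; exact: IH.
elim: w => [//|l w IH].
rewrite /invw /= rev_cons -cats1 /mulw foldr_cat /= invlK eqxx.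
exact: IH.
Qed.

Definition F2one : F2 := @ReducedWord [::] isT.
Definition F2mul (g h : F2) : F2 :=
  ReducedWord (mulw_reduced (word g) (word_reduced h)).
Definition F2inv (g : F2) : F2 := ReducedWord (invw_reduced (word_reduced g)).

Lemma F2mulA : associative F2mul.
Proof. by move=> g h k; apply/val_inj/mulwA/word_reduced. Qed.

Lemma F2mul1g : left_id F2one F2mul.
Proof. by move=> g; exact/val_inj. Qed.

Lemma F2mulg1 : right_id F2one F2mul.
Proof. by move=> g; apply/val_inj/mulw0/word_reduced. Qed.

Lemma F2mulVg : left_inverse F2one F2inv F2mul.
Proof. by move=> g; apply/val_inj/mulVw. Qed.

Lemma F2mulgV : right_inverse F2one F2inv F2mul.
Proof. by move=> g; apply/val_inj; rewrite /= -{1}[word g]invwK mulVw. Qed.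

HB.instance Definition _ :=
  isGroup.Build F2 F2mulA F2mul1g F2mulg1 F2mulVg F2mulgV.

End FreeGroup.

Definition gen (l : letter) : F2 := @ReducedWord [:: l] isT.
Definition gen_a : F2 := gen (false, true).
Definition gen_b : F2 := gen (true, true).

Section UniversalProperty.
Local Open Scope group_scope.
Variables (G : groupType) (x y : G).

Let evl (l : letter) : G :=
  let z := if l.1 then y else x in if l.2 then z else z^-1.
Let ev (w : seq letter) : G := \prod_(l <- w) evl l.

Let evl_inv l : evl (invl l) = (evl l)^-1.
Proof. by case: l => [a []]; rewrite /evl //= invgK. Qed.

Let ev_consl l w : ev (consl l w) = evl l * ev w.
Proof.
rewrite /ev; case: w => [|m w] /=; first by rewrite big_seq1 big_nil mulg1.
case: (m =P invl l) => [->|_]; last by rewrite !big_cons.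
by rewrite big_cons evl_inv mulgA mulgV mul1g.
Qed.

Let gen_inv l : gen (invl l) = (gen l)^-1.
Proof. exact/val_inj. Qed.

Lemma F2_free : exists! f : F2 -> G,
  [/\ {morph f : g h / g * h}, f gen_a = x & f gen_b = y].
Proof.
exists (fun g => ev (word g)); split; first split.
- move=> g h; rewrite /= /mulw; elim: (word g) => [|l u IH] /=.
    by rewrite /ev big_nil mul1g.
  by rewrite ev_consl IH mulgA; congr (_ * _); rewrite /ev big_cons.
- by rewrite /ev /= big_seq1.
- by rewrite /ev /= big_seq1.
move=> f [fM fa fb]; apply/funext => -[w rw] /=.
have f1 : f 1 = 1 by apply: (mulgI (f 1)); rewrite -fM !mulg1.
have fV g : f g^-1 = (f g)^-1.
  by apply: (mulgI (f g)); rewrite -fM !mulgV.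
have fgen l : f (gen l) = evl l.
  case: l => [[] []]; rewrite /evl //=.
  - by rewrite -[(true, false)]/(invl (true, true)) gen_inv fV fb.
  - by rewrite -[(false, false)]/(invl (false, true)) gen_inv fV fa.
elim: w rw => [|l w IH] rw.
  by rewrite /ev big_nil -f1; congr f; exact/val_inj.
have rw' := reduced_behead rw.
have -> : ReducedWord rw = gen l * ReducedWord rw'.
  by apply/val_inj; rewrite /= consl_id.
by rewrite fM fgen -(IH rw') /ev big_cons.
Qed.

End UniversalProperty.

Local Open Scope classical_set_scope.
Local Open Scope ring_scope.

Definition ball2 (N : nat) : set F2 := [set g | (size (word g) <= N)%N].

Lemma finite_ball2 N : finite_set (ball2 N).
Proof.
apply: (@sub_finite_set _ _ (\bigcup_(k in `I_N.+1)
  range (fun t : k.-tuple letter => insubd (1%g : F2) (tval t)))).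
  move=> g gN; exists (size (word g)) => //; exists (in_tuple (word g)) => //.
  exact: (valKd (1%g : F2)).
by apply: bigcup_finite => // k _; apply: finite_image; exact: finite_finset.
Qed.

(* `fset_set` sends an infinite set to the empty one, so the sets B N are meant
   to be finite, as ball2 N is by finite_ball2. *)
Definition upper_density (R : realType) (K : choiceType) (B : nat -> set K)
    (C : set K) : \bar R :=
  limn_esup (fun N =>
    ((#|` fset_set (C `&` B N)|)%:R / (#|` fset_set (B N)|)%:R)%:E).

Record measure_preserving_system (K : groupType) (d : measure_display)
    (X : measurableType d) (R : realType) (mu : probability X R)
    (T : K -> X -> X) : Prop := {
  mps_act1 : T 1%g = id;
  mps_actM : forall k l, T (k * l)%g = T k \o T l;
  mps_measurable : forall k, measurable_fun setT (T k);
  mps_preserving : forall k A, measurable A -> mu (T k @^-1` A) = mu A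
}.

(* Main.v *)
Require Import Defs.
From mathcomp Require Import all_boot all_order all_algebra.
From mathcomp Require Import finmap lra ring zify.
From mathcomp Require Import all_classical all_reals all_analysis measurable_realfun.

Set Implicit Arguments.
Unset Strict Implicit.
Unset Printing Implicit Defensive.

Import Order.TTheory GRing.Theory Num.Theory.

(** Write U_g = T_(g,g) and, for a point x, let
    C_x = {g : T_(g,1) x in Y and T_(1,g^-1) x in Y}.
    If g and h belong to C_x, then x lies in
    T_(g,1)^-1 Y /\ T_(1,h^-1)^-1 Y, a set whose measure is that of
    Y /\ T_(g,h) Y, because the two coordinate actions commute
    ([measure_meeting]).  There are countably many pairs (g, h), so once a null
    set of points is discarded, every C_x satisfies the second requirement.

    It remains to find such an x for which C_x has upper density at least
    mu(Y)^2.  By the reverse Fatou lemma ([exists_limn_esup_ge]) it suffices to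
    bound the upper limit of the integrals of |C_x /\ B_N| / |B_N|, which are
    the averages over g in B_N of phi(g) = mu(Y /\ U_g^-1 Y).

    The free group is not amenable and the averages of phi over B_N need not
    converge, but their upper limit is at least mu(Y)^2 for the following
    reason.  Since phi(k h^-1) = mu(U_h^-1 Y /\ U_k^-1 Y), the Cauchy-Schwarz
    inequality bounds the sum of phi(k h^-1) over h, k in B_N from below by
    |B_N|^2 mu(Y)^2 ([sqr_sum_measure_le]).  On the other hand g occurs as
    k h^-1 exactly |B_N /\ g^-1 B_N| times.  In the Cayley tree this is the size
    of the intersection of two balls of radius N whose centers are |g| apart,
    which depends on |g| only and decreases with |g| ([ncard_ball_translate],
    [leq_lens]).  A radial decreasing function is a combination of indicators of
    balls B_M with nonnegative coefficients, so a weighted mean of the averages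
    of phi over the B_M, M <= 2N, is at least mu(Y)^2.  The total weight of
    the balls with M < K is at most |B_K| / |B_N|, which tends to 0, so the
    averages over arbitrarily large balls get above any s < mu(Y)^2
    ([ball_averages_gt]). *)

Local Open Scope classical_set_scope.

(** * Word length and cancellation in the free group *)

Notation wlen g := (size (word g)).
Definition starts (l : letter) (g : F2) : bool := ohead (word g) == Some l.
Definition ncard (A : set F2) : nat := #|` fset_set A|.

Lemma mulw_cat u v : reduced (u ++ v) -> mulw u v = u ++ v.
Proof.
elim: u => [//|l u IH] r /=.
by rewrite IH ?consl_id //; exact: reduced_behead r.
Qed.

Lemma size_consl l w : size (consl l w) <= (size w).+1.
Proof. by case: w => [//|m w] /=; case: ifP => _ /=; lia. Qed.

Lemma size_mulw u v : size (mulw u v) <= size u + size v.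
Proof.
elim: u => [//|l u IH] /=; apply: leq_trans (size_consl _ _) _.
by rewrite addSn ltnS.
Qed.

Lemma wlen_mul g h : wlen (g * h)%g <= wlen g + wlen h.
Proof. exact: size_mulw. Qed.

Lemma wlen_inv g : wlen (g^-1)%g = wlen g.
Proof. by rewrite /= size_rev size_map. Qed.

Lemma reduced_rcons_cat u l v :
  reduced (rcons u l) -> reduced v -> ohead v != Some (invl l) ->
  reduced (rcons u l ++ v).
Proof.
case: v => [|m v] ru rv; first by rewrite cats0.
rewrite -[Some _ == _]/(m == invl l) => ne.
have {}ru : sorted (fun a b => b != invl a) (rcons u l ++ [:: m]).
  rewrite cat_rcons sorted_cat_cons.
  by apply/andP; split => //=; rewrite ne.
by rewrite /reduced sorted_cat_cons -cats1 ru.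
Qed.

Lemma wlen_rcons_mul u l (g : F2) (ru : reduced (rcons u l)) :
  ~~ starts (invl l) g ->
  wlen (ReducedWord ru * g)%g = (size u + wlen g).+1.
Proof.
move=> ns; rewrite /= mulw_cat ?size_cat ?size_rcons//.
by apply: reduced_rcons_cat => //; exact: word_reduced.
Qed.

(** The last letter of the left factor cancels against the first letter of g,
    so at least two letters disappear. *)
Lemma wlen_rcons_mul_le u l (g : F2) (ru : reduced (rcons u l)) :
  starts (invl l) g ->
  (wlen (ReducedWord ru * g)%g).+1 <= size u + wlen g.
Proof.
case: g => -[|m w] rw //= /eqP[->].
rewrite /mulw -cats1 foldr_cat /=.
have rw' : reduced w by exact: reduced_behead rw.
by rewrite eqxx; have := size_mulw u w; rewrite /mulw; lia.
Qed.

(** * Intersections of two balls *)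

Lemma finite_sub_ball N (A : set F2) : A `<=` ball2 N -> finite_set A.
Proof. by move=> /sub_finite_set; apply; exact: finite_ball2. Qed.

Lemma ncard_translate g (A : set F2) : finite_set A ->
  ncard ((fun h => g * h)%g @` A) = ncard A.
Proof.
move=> fA; rewrite /ncard fset_set_image// card_imfset//=.
exact: mulgI.
Qed.

Lemma ncard_split (A B : set F2) : finite_set A ->
  ncard A = ncard (A `&` B) + ncard (A `\` B).
Proof.
move=> fA; rewrite /ncard -[in LHS](setUIDK A B) fset_setU; last 2 first.
- exact: finite_setIl.
- exact: finite_setD.
rewrite cardfsU (_ : (_ `&` _)%fset = fset0) ?cardfs0 ?subn0//.
rewrite -fset_setI; last 2 first.
- exact: finite_setIl.
- exact: finite_setD.
by rewrite setIACA setICr setI0 fset_set0.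
Qed.

(** In the Cayley tree, the elements starting with l are the vertices behind the
    edge from 1 to l.  The radius is written N - j, through an addition, so that
    these sets become empty, instead of shrinking to {1}, when j > N. *)
Definition off_cone (N j : nat) (l : letter) : set F2 :=
  [set g | ~~ starts l g /\ wlen g + j <= N].
Definition cone (N j : nat) (l : letter) : set F2 :=
  [set g | starts l g /\ wlen g + j <= N].

Lemma finite_off_cone N j l : finite_set (off_cone N j l).
Proof. by apply: (@finite_sub_ball N) => g [_ lg]; rewrite /ball2 /=; lia. Qed.

Lemma finite_cone N j l : finite_set (cone N j l).
Proof. by apply: (@finite_sub_ball N) => g [_ lg]; rewrite /ball2 /=; lia. Qed.

Lemma gen_inv l : gen (invl l) = (gen l)^-1%g.
Proof. exact/val_inj. Qed.

(** Crossing an edge of the tree: the branch behind the edge labelled by the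
    inverse of l is a copy of what is seen from its far end without turning
    back. *)
Lemma cone_translate N j l :
  cone N j (invl l) = (fun h => gen (invl l) * h)%g @` off_cone N j.+1 l.
Proof.
apply/seteqP; split=> g.
  case=> sg lg; exists (gen l * g)%g; last by rewrite gen_inv mulKg.
  case: g sg lg => -[|m w] rw //= /eqP[em] lw; subst m.
  rewrite /off_cone /starts /= eqxx; split; last by lia.
  by case: w rw lw => [//|m w] /= /andP[+ _] _; rewrite invlK.
case=> h [nh lh] <-.
have e : word (gen (invl l) * h)%g = invl l :: word h.
  move: nh; case: h lh => -[//|m w] rw lw; rewrite /starts /= invlK => ne.
  by rewrite ifN.
by split; rewrite /starts e ?eqxx //=; lia.
Qed.

Lemma ncard_ball_cone N j l :
  ncard [set g | wlen g + j <= N] =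
  ncard (off_cone N j l) + ncard (off_cone N j.+1 (invl l)).
Proof.
rewrite (@ncard_split _ [set g | ~~ starts l g]); last first.
  by apply: (@finite_sub_ball N) => g /= lg; rewrite /ball2 /=; lia.
congr (_ + _).
  by congr ncard; apply/seteqP; split => g [].
have -> : [set g | wlen g + j <= N] `\` [set g | ~~ starts l g] =
          cone N j (invl (invl l)).
  rewrite invlK; apply/seteqP; split => g []; first by move=> ? /negP; rewrite negbK.
  by move=> sg ?; split => //=; apply/negP; rewrite negbK.
by rewrite cone_translate ncard_translate//; exact: finite_off_cone.
Qed.

Lemma ncard_off_cone_out N j l : N < j -> ncard (off_cone N j l) = 0.
Proof.
move=> Nj; rewrite (_ : off_cone N j l = set0) /ncard ?fset_set0 ?cardfs0//.
by apply/seteqP; split => // g [_]; lia.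
Qed.

(** Every letter gives the same count, by [ncard_off_cone]. *)
Definition ocard N j := ncard (off_cone N j (false, true)).

(** The left side of [ncard_ball_cone] does not mention the letter l, which
    reduces the independence of l at j to that at j + 1; for j > N the sets are
    empty. *)
Lemma ncard_off_cone N j l : ncard (off_cone N j l) = ocard N j.
Proof.
rewrite /ocard; have [n] := ubnP (N.+1 - j).
elim: n j l => // n IH j l nj.
have [Nj|jN] := ltnP N j; first by rewrite !ncard_off_cone_out.
have := ncard_ball_cone N j l; rewrite (ncard_ball_cone N j (false, true)).
have nj1 : N.+1 - j.+1 < n by lia.
by rewrite !(IH j.+1 _ nj1); lia.
Qed.

Lemma leq_ocard N j k : j <= k -> ocard N k <= ocard N j.
Proof.
move=> jk; apply: fsubset_leq_card; rewrite -fset_set_sub.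
- by move=> g [sg ?]; split => //; lia.
- exact: finite_off_cone.
- exact: finite_off_cone.
Qed.

(** Number of points common to two balls of radius N whose centers are at
    distance m.  For m > 0, an edge at the middle of the geodesic between the
    centers cuts the tree in two halves, and a point is at least as far from the
    center in the other half as from that in its own half.  So the intersection
    consists of two half-balls, one at each end of that edge.  For m = 0 any edge
    at the common center will do. *)
Definition lens (N m : nat) : nat := ocard N (uphalf m) + ocard N m./2.+1.

Lemma leq_lens N m k : m <= k -> lens N k <= lens N m.
Proof. by move=> mk; apply: leq_add; apply: leq_ocard; lia. Qed.

Lemma lens_out N m : N.*2 < m -> lens N m = 0.
Proof. by move=> mN; rewrite /lens /ocard !ncard_off_cone_out//; lia. Qed.

Lemma ncard_ball N : ncard (ball2 N) = lens N 0.
Proof.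
rewrite /lens -(ncard_off_cone N 1 (invl (false, true))) -ncard_ball_cone.
by congr ncard; apply/seteqP; split => g /=; rewrite addn0.
Qed.

(** Write g = P Q with P = p l reduced and Q of length half that of g,
    rounded down.  The translation by Q puts the cutting edge at the identity:
    the set becomes that of the h for which both P h and Q^-1 h have length at
    most N.  If h does not start with the inverse of l, then nothing cancels in
    P h, and this is the stronger condition.  If it does, then P h loses at
    least two letters, while nothing cancels in Q^-1 h because l is followed by
    Q in the reduced word g. *)
Lemma ncard_ball_translate N (g : F2) :
  ncard [set h | wlen h <= N /\ wlen (g * h)%g <= N] = lens N (wlen g).
Proof.
have [->|g0] := eqVneq g 1%g.
  rewrite -ncard_ball; congr ncard; apply/seteqP; split=> h; last first.
    by move=> lh; split; rewrite ?mul1g.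
  by case.
case: g g0 => w rw w0; set g := ReducedWord rw; rewrite [wlen g]/=.
set m := size w; set i := uphalf m.
have m0 : 0 < m.
  by rewrite lt0n; apply: contra w0 => /nilP w0; apply/eqP/val_inj.
have [p [l [q [ew sp]]]] : exists p l q, w = rcons p l ++ q /\ (size p).+1 = i.
  exists (take i.-1 w), (nth (false, true) w i.-1), (drop i w); split.
    have -> : drop i w = drop i.-1.+1 w by congr drop; rewrite /i; lia.
    by rewrite cat_rcons -drop_nth ?cat_take_drop//; rewrite /i -/m; lia.
  by rewrite size_take -/m; case: ltnP; rewrite /i; lia.
have sq : size q = m./2 by have := erefl m; rewrite {1}/m ew size_cat size_rcons sp /i; lia.
have rp : reduced (rcons p l).
  by have := rw; rewrite ew /reduced cat_rcons sorted_cat_cons => /andP[].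
have rlq : reduced (l :: q).
  by have := rw; rewrite ew /reduced cat_rcons sorted_cat_cons => /andP[].
have rq : reduced q := reduced_behead rlq.
pose P := ReducedWord rp; pose Q := ReducedWord rq.
have gE : g = (P * Q)%g by apply/val_inj; rewrite /= mulw_cat -?ew.
have riq : reduced (rcons (invw q) (invl l)).
  by have := invw_reduced rlq; rewrite /invw /= rev_cons.
have QmulE h : starts (invl l) h -> wlen (Q^-1 * h)%g = size q + wlen h.
  case: h => -[|k h] rh //= /eqP[ek]; subst k.
  rewrite mulw_cat ?size_cat ?size_rev ?size_map// /reduced sorted_cat_cons.
  by apply/andP; split.
have sQ h : wlen (Q^-1 * h)%g <= size q + wlen h.
  by rewrite -[size q]/(wlen Q) -(wlen_inv Q) wlen_mul.
have PmulE h : ~~ starts (invl l) h -> wlen (P * h)%g = i + wlen h.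
  by move=> sh; rewrite wlen_rcons_mul// -sp.
have sP h : starts (invl l) h -> (wlen (P * h)%g).+2 <= i + wlen h.
  by move=> sh; have := wlen_rcons_mul_le rp sh; rewrite -sp.
have iq : size q <= i <= (size q).+1 by rewrite sq /i; lia.
pose S : set F2 := [set h | wlen (Q^-1 * h)%g <= N /\ wlen (P * h)%g <= N].
have -> : [set h | wlen h <= N /\ wlen (g * h)%g <= N] = (fun h => Q^-1 * h)%g @` S.
  apply/seteqP; split=> h.
    case=> h1 h2; exists (Q * h)%g; last by rewrite mulKg.
    by split; rewrite ?mulKg// mulgA -gE.
  by case=> k [k1 k2] <-; split => //; rewrite gE mulgA mulgK.
have SE1 : S `\` [set h | ~~ starts (invl l) h] = cone N (size q) (invl l).
  apply/seteqP; split => h.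
    case=> -[h1 h2] /negP; rewrite negbK => sh; split => //.
    by rewrite addnC -QmulE.
  case=> sh hN; have := sP h sh.
  split; last by apply/negP; rewrite negbK.
  by split; [rewrite QmulE//|]; lia.
have SE2 : S `&` [set h | ~~ starts (invl l) h] = off_cone N i (invl l).
  apply/seteqP; split => h.
    by case=> -[h1 h2] sh; split => //; rewrite addnC -PmulE.
  case=> sh hN; have := sQ h; split => //.
  by split; [|rewrite PmulE//]; lia.
have fS : finite_set S.
  rewrite -(setUIDK S [set h | ~~ starts (invl l) h]) SE1 SE2 finite_setU.
  by split; [exact: finite_off_cone|exact: finite_cone].
rewrite ncard_translate// (@ncard_split _ [set h | ~~ starts (invl l) h])//.
rewrite SE1 SE2 ncard_off_cone cone_translate ncard_translate ?ncard_off_cone ?sq//.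
exact: finite_off_cone.
Qed.
(** * Averages over balls *)

Notation ballf N := (fset_set (ball2 N)).

Lemma in_ballf N (g : F2) : (g \in ballf N) = (wlen g <= N).
Proof. by rewrite in_fset_set ?mem_setE//; exact: finite_ball2. Qed.

Local Open Scope ring_scope.

Lemma sum_ball_quotients (R : pzRingType) N (psi : F2 -> R) :
  \sum_(h <- ballf N) \sum_(k <- ballf N) psi (k * h^-1)%g =
  \sum_(g <- ballf N.*2) psi g *+ lens N (wlen g).
Proof.
have reindex h : h \in ballf N -> \sum_(k <- ballf N) psi (k * h^-1)%g =
    \sum_(g <- ballf N.*2 | (g * h)%g \in ballf N) psi g.
  rewrite in_ballf => hN.
  rewrite -(@big_imfset _ _ _ _ _ imfset_key (fun k => k * h^-1)%g (mem (ballf N)) psi) /=;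
    last by move=> x y _ _; exact: mulIg.
  rewrite -[RHS]big_filter; apply: perm_big; apply: uniq_perm.
  - exact: fset_uniq.
  - by apply: filter_uniq; exact: fset_uniq.
  move=> g; rewrite mem_filter !in_ballf.
  apply/imfsetP/andP => [[k]|].
    rewrite -[k \in _]/(k \in ballf N) in_ballf => kN ->; rewrite mulgVK; split => //.
    by apply: leq_trans (wlen_mul _ _) _; rewrite wlen_inv; lia.
  move=> [gN _]; exists (g * h)%g; last by rewrite mulgK.
  by rewrite -[_ \in _]/(_ \in ballf N) in_ballf.
rewrite big_seq (eq_bigr _ reindex) -big_seq (exchange_big_dep predT)//=.
apply: eq_bigr => g _; rewrite big_const_seq iter_addr_0; congr (_ *+ _).
rewrite -ncard_ball_translate /ncard -size_filter.
apply/perm_size/uniq_perm.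
- by apply: filter_uniq; exact: fset_uniq.
- exact: fset_uniq.
move=> h; rewrite mem_filter !in_ballf in_fset_set ?mem_setE.
  by apply/andP/idP => [[? ?]|/set_mem[]] //; apply/mem_set.
by apply: (@finite_sub_ball N) => ? [].
Qed.

(** Layer-cake decomposition: the number lens N |g| is the sum of the
    successive drops of lens N at the radii M >= |g|, i.e. over the balls B_M
    containing g. *)
Lemma sum_lens (R : comPzRingType) N (psi : F2 -> R) :
  \sum_(g <- ballf N.*2) psi g *+ lens N (wlen g) =
  \sum_(0 <= M < N.*2.+1)
    ((lens N M)%:R - (lens N M.+1)%:R) * \sum_(g <- ballf M) psi g.
Proof.
transitivity (\sum_(g <- ballf N.*2) \sum_(0 <= M < N.*2.+1 | (wlen g <= M)%N)
    ((lens N M)%:R - (lens N M.+1)%:R) * psi g).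
  rewrite big_seq [RHS]big_seq; apply: eq_bigr => g; rewrite in_ballf => gN.
  rewrite -mulr_suml big_nat_cond -big_nat_cond.
  rewrite (big_cat_nat _ (n := wlen g))//=; last by lia.
  rewrite big_nat_cond big_pred0 ?add0r; last by move=> i; lia.
  rewrite big_nat_cond (eq_bigl (fun i => (wlen g <= i < N.*2.+1)%N)); last by move=> i; lia.
  rewrite -big_nat -[in LHS]mulr_natl; congr (_ * _).
  have := @telescope_sumr R (wlen g) N.*2.+1 (fun M => - (lens N M)%:R).
  rewrite (@lens_out N N.*2.+1)// => H.
  under eq_bigr do rewrite addrC -[X in _ + X]opprK.
  by rewrite H ?oppr0 ?add0r ?opprK//; lia.
rewrite (exchange_big_dep predT)//= big_nat [RHS]big_nat; apply: eq_bigr => M MN.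
rewrite mulr_sumr -[LHS]big_filter; apply: perm_big; apply: uniq_perm.
- by apply: filter_uniq; exact: fset_uniq.
- exact: fset_uniq.
by move=> g; rewrite mem_filter !in_ballf; lia.
Qed.

(** In the decomposition into balls, those of radius at least K contribute
    nonpositive terms, and each of the others at most B |B_K|, with coefficients
    of sum at most lens N 0 = |B_N|. *)
Lemma sum_ball_quotients_le (R : realDomainType) (psi : F2 -> R) (B : R) (K N : nat) :
  0 <= B -> (forall g, psi g <= B) ->
  (forall M, (K <= M)%N -> \sum_(g <- ballf M) psi g <= 0) ->
  \sum_(h <- ballf N) \sum_(k <- ballf N) psi (k * h^-1)%g <=
    (ncard (ball2 N))%:R * (B *+ ncard (ball2 K)).
Proof.
move=> B0 psiB psiK; rewrite sum_ball_quotients sum_lens.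
apply: (@le_trans _ _ (\sum_(0 <= M < N.*2.+1)
    ((lens N M)%:R - (lens N M.+1)%:R) * (B *+ ncard (ball2 K)))).
  apply: ler_sum => M _; apply: ler_wpM2l.
    by rewrite subr_ge0 ler_nat leq_lens.
  have [KM|MK] := leqP K M.
    by apply: le_trans (psiK _ KM) _; rewrite mulrn_wge0.
  apply: (@le_trans _ _ (\sum_(g <- ballf M) B)); first exact: ler_sum.
  rewrite big_const_seq iter_addr_0 count_predT; apply: ler_wpMn2l => //.
  apply: fsubset_leq_card; apply/fsubsetP => g; rewrite !in_ballf; lia.
rewrite -mulr_suml ler_wpM2r ?mulrn_wge0// ncard_ball.
have := @telescope_sumr R 0 N.*2.+1 (fun M => - (lens N M)%:R) isT.
under eq_bigr do rewrite opprK addrC.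
by rewrite (@lens_out N N.*2.+1)// => ->; rewrite oppr0 add0r opprK.
Qed.

Lemma ncard_ball_gt N : (N < ncard (ball2 N))%N.
Proof.
have rn n : reduced (nseq n (false, true)) by elim: n => // -[].
elim: N => [|N IH].
  by rewrite cardfs_gt0; apply/fset0Pn; exists 1%g; rewrite in_ballf.
apply: leq_ltn_trans IH _; apply: fproper_ltn_card; rewrite fproperEneq.
apply/andP; split; last by apply/fsubsetP => g; rewrite !in_ballf => /leqW.
apply/eqP => /fsetP/(_ (ReducedWord (rn N.+1))).
by rewrite !in_ballf /= size_nseq ltnn leqnn.
Qed.

(** The bound [sum_ball_quotients_le] is linear in |B_N|, whereas the hypothesis
    provides a quadratic lower bound for the same sum.  If the averages of phi
    were eventually at most s, applying the former to phi - s would yield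
    (m - s) |B_N| <= C for a constant C, although |B_N| is unbounded. *)
Lemma ball_averages_gt (R : archiRealFieldType) (phi : F2 -> R) (m B s : R) :
  (forall g, phi g <= B) ->
  (forall N, m * (ncard (ball2 N))%:R ^+ 2 <=
    \sum_(h <- ballf N) \sum_(k <- ballf N) phi (k * h^-1)%g) ->
  s < m ->
  forall K, exists2 M, (K <= M)%N &
    s * (ncard (ball2 M))%:R < \sum_(g <- ballf M) phi g.
Proof.
move=> phiB pos sm K; apply: contrapT => /forall2NP no.
have {}no M : (K <= M)%N -> \sum_(g <- ballf M) (phi g - s) <= 0.
  move=> KM; case: (no M) => [//|/negP]; rewrite -leNgt => le.
  by rewrite sumrB big_const_seq iter_addr_0 count_predT -mulr_natr subr_le0.
pose C : R := `|B - s| *+ ncard (ball2 K).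
have bound N : (m - s) * (ncard (ball2 N))%:R <= C.
  have c0 : 0 < (ncard (ball2 N))%:R :> R.
    by rewrite ltr0n; exact: leq_ltn_trans (ncard_ball_gt N).
  rewrite -(ler_pM2l c0); apply: le_trans (@sum_ball_quotients_le _
    (fun g => phi g - s) `|B - s| K N (normr_ge0 _) _ no); last first.
    by move=> g; apply: le_trans (ler_norm _); rewrite lerB.
  under eq_bigr do rewrite sumrB big_const_seq iter_addr_0 count_predT.
  rewrite sumrB big_const_seq iter_addr_0 count_predT.
  rewrite [X in X <= _](_ : _ = m * (ncard (ball2 N))%:R ^+ 2 -
    s * (ncard (ball2 N))%:R ^+ 2); last by ring.
  by rewrite -mulrnA -[s *+ _]mulr_natr natrM -expr2 lerB.
have ms : 0 < m - s by rewrite subr_gt0.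
have := bound (Num.truncn (C / (m - s))); rewrite mulrC -ler_pdivlMr// leNgt.
move=> /negP; apply; apply: lt_le_trans (truncnS_gt _) _.
by rewrite ler_nat; exact: ncard_ball_gt.
Qed.
(** * Measure-theoretic lemmas *)

Lemma integral_probability_cst (R : realType) (d : measure_display)
    (X : measurableType d) (mu : probability X R) (r : R) :
  (\int[mu]_x r%:E = r%:E)%E.
Proof.
by rewrite integral_cst// -[RHS]mule1; congr (_ * _)%E; exact: probability_setT.
Qed.

Lemma integral_sum_indic (R : realType) (d : measure_display)
    (X : measurableType d) (mu : measure X R) (I : Type) (s : seq I)
    (E : I -> set X) : (forall i, measurable (E i)) ->
  (\int[mu]_x (\sum_(i <- s) (\1_(E i) x : R))%:E = \sum_(i <- s) mu (E i))%E.
Proof.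
move=> mE; under eq_integral do rewrite -sumEFin.
rewrite ge0_integral_sum//; last first.
  by move=> i; apply/measurable_EFinP; exact: measurable_indic.
by apply: eq_bigr => i _; rewrite integral_indic// setIT.
Qed.

Lemma measurable_sum_indic (R : realType) (d : measure_display)
    (X : measurableType d) (I : Type) (s : seq I) (E : I -> set X) :
  (forall i, measurable (E i)) ->
  measurable_fun setT (fun x => \sum_(i <- s) (\1_(E i) x : R)).
Proof. by move=> mE; apply: measurable_sum => i; exact: measurable_indic. Qed.

(** Cauchy-Schwarz for the counting function F of the events E i, whose integral
    is m.  Integrating 2 m F <= F^2 + m^2 gives it while all integrands stay
    nonnegative. *)
Lemma sqr_sum_measure_le (R : realType) (d : measure_display)
    (X : measurableType d) (mu : probability X R) (I : Type) (s : seq I)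
    (E : I -> set X) : (forall i, measurable (E i)) ->
  (\sum_(i <- s) fine (mu (E i))) ^+ 2 <=
  \sum_(i <- s) \sum_(j <- s) fine (mu (E i `&` E j)).
Proof.
move=> mE; set m := \sum_(i <- s) fine (mu (E i)).
have m0 : 0 <= m by apply: sumr_ge0 => i _; exact: fine_ge0.
pose F x := \sum_(i <- s) (\1_(E i) x : R).
have F0 x : 0 <= F x by apply: sumr_ge0.
pose EE (p : I * I) := E p.1 `&` E p.2.
have mEE p : measurable (EE p) by exact: measurableI.
have FF x : F x ^+ 2 = \sum_(p <- [seq (i, j) | i <- s, j <- s]) (\1_(EE p) x : R).
  rewrite big_allpairs expr2 mulr_suml; apply: eq_bigr => i _.
  by rewrite mulr_sumr; apply: eq_bigr => j _; rewrite indicI.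
have fin A : measurable A -> (fine (mu A))%:E = mu A.
  by move=> mA; rewrite fineK// fin_num_measure.
have mF : measurable_fun setT F by exact: measurable_sum_indic.
have iF : (\int[mu]_x (F x)%:E = m%:E)%E.
  rewrite integral_sum_indic// /m -sumEFin; apply: eq_bigr => i _.
  by rewrite fin.
have : (\int[mu]_x (2 * m * F x)%:E <= \int[mu]_x (F x ^+ 2 + m ^+ 2)%:E)%E.
  apply: ge0_le_integral => //.
  - by move=> x _; rewrite lee_fin !mulr_ge0.
  - by apply/measurable_EFinP; exact: measurable_funM.
  - by apply/measurable_EFinP; apply: measurable_funD => //; exact: measurable_funX.
  - by move=> x _; rewrite lee_fin; have := sqr_ge0 (F x - m); nra.
under eq_integral do rewrite EFinM.
rewrite ge0_integralZl//; last 3 first.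
- exact/measurable_EFinP.
- by move=> x _; rewrite lee_fin.
- by rewrite lee_fin mulr_ge0.
rewrite iF; under eq_integral do rewrite EFinD.
rewrite ge0_integralD//; last 3 first.
- by move=> x _; rewrite lee_fin sqr_ge0.
- by apply/measurable_EFinP; exact: measurable_funX.
- by move=> x _; rewrite lee_fin sqr_ge0.
rewrite integral_probability_cst.
under eq_integral do rewrite FF.
rewrite integral_sum_indic// big_allpairs.
rewrite (_ : (\sum_(i <- s) _)%E =
    (\sum_(i <- s) \sum_(j <- s) fine (mu (E i `&` E j)))%:E); last first.
  rewrite -sumEFin; apply: eq_bigr => i _; rewrite -sumEFin.
  by apply: eq_bigr => j _; rewrite fin//; exact: (mEE (i, j)).
by rewrite -EFinM -EFinD lee_fin => ?; nra.
Qed.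

(** Reverse Fatou lemma.  Otherwise the lower limit L of 1 - u_n would exceed
    1 - c almost everywhere, while its integral is at most 1 - c by the Fatou
    lemma. *)
Lemma exists_limn_esup_ge (R : realType) (d : measure_display)
    (X : measurableType d) (mu : probability X R) (u : nat -> X -> R) (c : R)
    (Z : set X) :
  (forall n, measurable_fun setT (u n)) -> (forall n x, 0 <= u n x <= 1) ->
  measurable Z -> mu Z = 0%E ->
  (forall s K, s < c -> exists2 n, (K <= n)%N & (s%:E <= \int[mu]_x (u n x)%:E)%E) ->
  exists2 x, ~ Z x & (c%:E <= limn_esup (fun n => (u n x)%:E))%E.
Proof.
move=> mu_ u01 mZ Z0 big; apply: contrapT => /forall2NP no.
have {}no x : ~ Z x -> (limn_esup (fun n => (u n x)%:E) < c%:E)%E.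
  by move=> Zx; case: (no x) => [//|/negP]; rewrite -ltNge.
pose v n x : \bar R := (1%:E - (u n x)%:E)%E.
have mv n : measurable_fun setT (v n).
  by apply: emeasurable_funB => //; exact/measurable_EFinP.
have v0 n x : (0 <= v n x)%E.
  by rewrite sube_ge0// lee_fin; case/andP: (u01 n x).
pose L x := limn_einf (v^~ x).
have LE x : L x = (1%:E - limn_esup (fun n => (u n x)%:E))%E.
  by rewrite /L limn_einf_shift// -limn_einfN.
have mL : measurable_fun setT L.
  apply: measurableT_comp => //; apply: measurable_fun_limn_esup => n.
  exact: measurableT_comp.
have L0 x : (0 <= L x)%E.
  rewrite /L limn_einf_lim; apply: lime_ge; first exact: is_cvg_einfs.
  by apply: nearW => n; apply/ereal_infP => _ [m _ <-].
have iv n : (\int[mu]_x v n x = 1 - \int[mu]_x (u n x)%:E)%E.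
  have u0 x : (0 <= (u n x)%:E)%E by rewrite lee_fin; case/andP: (u01 n x).
  have mun : measurable_fun setT (fun x => (u n x)%:E) by exact/measurable_EFinP.
  have <- : (\int[mu]_x v n x + \int[mu]_x (u n x)%:E = 1)%E.
    rewrite -ge0_integralD// -[RHS](integral_probability_cst mu 1).
    by apply: eq_integral => x _; rewrite subeK.
  rewrite addeK// ge0_fin_numE ?integral_ge0//.
  apply: (@le_lt_trans _ _ (\int[mu]_x 1%:E)%E); last first.
    by rewrite integral_probability_cst ltry.
  apply: ge0_le_integral => // x _.
  by rewrite lee_fin; case/andP: (u01 n x).
have iL : (\int[mu]_x L x <= 1%:E - c%:E)%E.
  apply: le_trans (fatou mu measurableT mv (fun n x _ => v0 n x)) _.
  rewrite limn_einf_lim; apply: lime_le; first exact: is_cvg_einfs.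
  apply: nearW => K; apply/lee_addgt0Pr => e e0.
  have [|n Kn un] := big (c - e) K; first by rewrite ltrBlDr ltrDl.
  apply: (@le_trans _ _ (\int[mu]_x v n x)%E).
    by apply: ereal_inf_lbound; exists n.
  rewrite iv -EFinB -EFinD (_ : 1 - c + e = 1 - (c - e)); last by ring.
  by rewrite EFinB leeB.
pose D := ~` Z; have mD : measurable D by exact: measurableC.
have D1 : mu D = 1%E by rewrite probability_setC// Z0 sube0.
have c1 : 0 <= 1 - c.
  by rewrite -lee_fin; apply: le_trans iL; exact: integral_ge0.
pose w x : \bar R := (L x - (1 - c)%:E)%E.
have w_gt0 x : D x -> (0 < w x)%E.
  by move=> Dx; rewrite /w sube_gt0 LE EFinB lteD2lE// lteN2 no.
have mw : measurable_fun D w.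
  by apply: emeasurable_funB => //; exact: measurable_funS mL.
have : (\int[mu]_(x in D) L x <= (1 - c)%:E)%E.
  by apply: le_trans iL; apply: ge0_subset_integral.
rewrite (eq_integral (fun x => (1 - c)%:E + w x)%E); last first.
  by move=> x _; rewrite /w addeC subeK.
rewrite ge0_integralD//; last by move=> x /w_gt0/ltW.
rewrite integral_cst// [X in (_ * X)%E]D1 mule1 -[leRHS]adde0 leeD2lE// => w_le0.
have : (\int[mu]_(x in D) `|w x| = 0)%E.
  apply/eqP; rewrite eq_le; apply/andP; split; last exact: integral_ge0.
  apply: le_trans w_le0; rewrite le_eqVlt; apply/orP; left; apply/eqP.
  by apply: eq_integral => x /set_mem /w_gt0 /ltW; exact: gee0_abs.
move/(ae_eq_integral_abs mu mD mw) => w_ae0.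
suff : mu D = 0%E by rewrite D1 => /eqP; rewrite onee_eq0.
apply/negligibleP => //; apply: negligibleS w_ae0 => x Dx /= /(_ Dx) w0.
by have := w_gt0 x Dx; rewrite w0 ltxx.
Qed.


Lemma sum_indic_ballf (R : pzRingType) (X : Type) (E : F2 -> set X) (x : X) N :
  \sum_(g <- ballf N) \1_(E g) x = (ncard ([set g | E g x] `&` ball2 N))%:R :> R.
Proof.
under eq_bigr do rewrite indicE.
rewrite -natr_sum; congr _%:R.
rewrite (eq_bigr (fun g => if x \in E g then 1%N else 0%N)); last first.
  by move=> g _; case: (x \in E g).
rewrite -big_mkcond sum1_count -size_filter; apply/perm_size/uniq_perm.
- by apply: filter_uniq; exact: fset_uniq.
- exact: fset_uniq.
move=> g; rewrite mem_filter in_ballf in_fset_set ?mem_setE; last first.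
  by apply: (@finite_sub_ball N) => ? [].
apply/andP/idP => [[/set_mem Eg gN]|/set_mem[Eg gN]]; first exact/mem_set.
by split => //; exact/mem_set.
Qed.

(** * The sets C_x and their densities *)

Section PairCorrelation.
Variables (R : realType) (d : measure_display) (X : measurableType d).
Variables (mu : probability X R) (T : F2 * F2 -> X -> X) (Y : set X).
Hypotheses (hT : measure_preserving_system mu T) (mY : measurable Y).

Let measurable_preimage_act k A : measurable A -> measurable (T k @^-1` A).
Proof. by move=> mA; rewrite -[_ @^-1` _]setTI; exact: (mps_measurable hT). Qed.

Let preimage_act k l A : T k @^-1` (T l @^-1` A) = T (l * k)%g @^-1` A.
Proof. by rewrite (mps_actM hT). Qed.

(** The points x for which g satisfies the first, and h the second, of the two
    conditions that define C_x. *)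
Definition meeting (g h : F2) : set X :=
  T (g, 1%g) @^-1` Y `&` T (1%g, (h^-1)%g) @^-1` Y.

Lemma measurable_meeting g h : measurable (meeting g h).
Proof. by apply: measurableI; exact: measurable_preimage_act. Qed.

Lemma image_act k : T k @` Y = T (k^-1)%g @^-1` Y.
Proof.
apply/seteqP; split => [_ [y Yy <-]|x Yx].
  by rewrite /= -[T _ (T _ _)]/((T _ \o T _) y) -(mps_actM hT) mulVg (mps_act1 hT).
exists (T k^-1%g x) => //.
by rewrite -[LHS]/((T _ \o T _) x) -(mps_actM hT) mulgV (mps_act1 hT).
Qed.

(** The set on the left is the preimage under T_(g,1) of that on the right. *)
Lemma measure_meeting g h : mu (meeting g h) = mu (Y `&` T (g, h) @` Y).
Proof.
rewrite image_act -[RHS](mps_preserving hT (g, 1%g)); last first.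
  by apply: measurableI => //; exact: measurable_preimage_act mY.
rewrite preimage_setI preimage_act /meeting.
have -> : ((g, h)^-1 * (g, 1) = (1, h^-1))%g by congr pair; rewrite /= ?mulVg ?mulg1.
by [].
Qed.

(** Preimage under T_(h,k), chosen so that it turns T_(k h^-1, 1) into
    T_(k,k) and T_(1, h k^-1) into T_(h,h). *)
Lemma measure_meeting_quotient h k :
  mu (meeting (k * h^-1)%g (k * h^-1)%g) =
  mu (T (h, h) @^-1` Y `&` T (k, k) @^-1` Y).
Proof.
rewrite -(mps_preserving hT (h, k) (measurable_meeting _ _)) setIC.
rewrite /meeting preimage_setI !preimage_act.
have -> : ((k * h^-1, 1) * (h, k) = (k, k))%g by congr pair; rewrite ?mul1g ?mulgVK.
have -> : ((1, (k * h^-1)^-1) * (h, k) = (h, h))%g.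
  by congr pair; rewrite ?mul1g// invgM invgK mulgVK.
by [].
Qed.

End PairCorrelation.

Theorem corollary1p10 (R : realType) (d : measure_display)
    (X : measurableType d) (mu : probability X R)
    (T : F2 * F2 -> X -> X) (hT : measure_preserving_system mu T)
    (Y : set X) (mY : measurable Y) :
  exists C : set F2,
    (mu Y ^+ 2 <= upper_density R ball2 C)%E /\
    C `*` C `<=` [set gh | (0 < mu (Y `&` (T gh @` Y)))%E].
Proof.
pose M g h := meeting T Y g h.
have mM g h : measurable (M g h) by exact: (measurable_meeting hT mY).
pose m := fine (mu Y).
have mE : mu Y = m%:E by rewrite fineK// fin_num_measure.
(* The null sets to avoid, indexed by codes of pairs (g, h). *)
pose Zn (n : nat) : set X := if (choice.unpickle n : option (F2 * F2)) is Some (g, h)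
  then (if mu (M g h) == 0%E then M g h else set0) else set0.
have mZn n : measurable (Zn n) /\ mu (Zn n) = 0%E.
  rewrite /Zn; case: choice.unpickle => [[g h]|]; last by rewrite measure0.
  by case: eqP => // _; rewrite measure0.
pose Z := \bigcup_n Zn n.
have mZ : measurable Z by apply: bigcupT_measurable => n; case: (mZn n).
have Z0 : mu Z = 0%E.
  apply/negligibleP => //; apply: negligible_bigcup => n.
  by apply/negligibleP; case: (mZn n).
have MZ x g h : ~ Z x -> M g h x -> (0 < mu (M g h))%E.
  move=> Zx Mx; rewrite lt0e measure_ge0 andbT; apply/eqP => M0; apply: Zx.
  by exists (choice.pickle (g, h)) => //; rewrite /Zn choice.pickleK M0 eqxx.
(* The proportion of C_x in B_N. *)
pose f N x : R := (\sum_(g <- ballf N) \1_(M g g) x) / (ncard (ball2 N))%:R.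
have c0 N : 0 < (ncard (ball2 N))%:R :> R.
  by rewrite ltr0n; exact: leq_ltn_trans (ncard_ball_gt N).
have mf N : measurable_fun setT (f N).
  by apply: measurable_funM => //; exact: measurable_sum_indic.
have f01 N x : 0 <= f N x <= 1.
  rewrite divr_ge0 ?sumr_ge0//= ler_pdivrMr// mul1r.
  apply: (@le_trans _ _ (\sum_(g <- ballf N) 1)).
    by apply: ler_sum => g _; rewrite indicE; case: (_ \in _).
  by rewrite big_const_seq iter_addr_0 count_predT.
have phi1 g : fine (mu (M g g)) <= 1.
  by rewrite -lee_fin fineK ?fin_num_measure// probability_le1.
have pos N : m ^+ 2 * (ncard (ball2 N))%:R ^+ 2 <=
    \sum_(h <- ballf N) \sum_(k <- ballf N) fine (mu (M (k * h^-1)%g (k * h^-1)%g)).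
  have mE' (g : F2) : measurable (T (g, g) @^-1` Y).
    by rewrite -[_ @^-1` _]setTI; exact: (mps_measurable hT).
  have := sqr_sum_measure_le mu (ballf N) mE'.
  under eq_bigr do rewrite (mps_preserving hT _ mY).
  rewrite big_const_seq iter_addr_0 count_predT -/m => le.
  rewrite -exprMn mulr_natr; apply: le_trans le _.
  rewrite le_eqVlt; apply/orP; left; apply/eqP; apply: eq_bigr => h _.
  by apply: eq_bigr => k _; rewrite /M (measure_meeting_quotient hT mY).
have big s K : s < m ^+ 2 ->
    exists2 N, (K <= N)%N & (s%:E <= \int[mu]_x (f N x)%:E)%E.
  move=> sm; have [N KN sN] := ball_averages_gt phi1 pos sm K.
  exists N => //; rewrite /f; under eq_integral do rewrite mulrC EFinM.
  rewrite ge0_integralZl//; last 2 first.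
  - by apply/measurable_EFinP; exact: measurable_sum_indic.
  - by move=> x _; rewrite lee_fin sumr_ge0.
  rewrite integral_sum_indic// (eq_bigr (fun g => (fine (mu (M g g)))%:E)); last first.
    by move=> g _; rewrite fineK// fin_num_measure.
  by rewrite sumEFin -EFinM lee_fin mulrC ler_pdivlMr// ltW.
have [x Zx dx] := exists_limn_esup_ge mf f01 mZ Z0 big.
exists [set g | M g g x]; split.
  rewrite mE -EFin_expe; apply: le_trans dx _.
  rewrite /upper_density le_eqVlt; apply/orP; left; apply/eqP.
  congr limn_esup; apply/funext => N; rewrite /f; congr (_ / _)%:E.
  exact: sum_indic_ballf.
move=> [g h] [/= [Mg _] [_ Mh]].
by rewrite -(measure_meeting hT mY); apply: (MZ x).
Qed.
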